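(* Let $\Gamma$ be a totally ordered abelian group, with associated hyperfield $H_\Gamma$ and Dress-Wenzel fuzzy ring $K_\Gamma$. There is a canonical isomorphism of fuzzy rings $\overline{\mathcal{F}}(H_\Gamma)\cong K_\Gamma$.
   Context: **Fuzzy rings.** A fuzzy ring is a tuple $(K;+,\times;\varepsilon,K_0)$ with $K$ a set, $+,\times$ binary operations on $K$, $\varepsilon\in K$, $K_0\subset K$, such that, with $K^\times$ the group of multiplicative units: (FR0) $(K,+)$ and $(K,\times)$ are commutative monoids with neutral elements $0$ and $1$; (FR1) $0\times a=0$ for all $a\in K$; (FR2) $a(b+c)=ab+ac$ for all $b,c\in K$, $a\in K^\times$; (FR3) $\varepsilon^2=1$; (FR4) $K_0+K_0\subseteq K_0$, $K\times K_0\subseteq K_0$, $0\in K_0$, $1\notin K_0$; (FR5) for $a\in K^\times$, $1+a\in K_0$ if and only if $a=\varepsilon$; (FR6) if $a+b\in K_0$ and $c+d\in K_0$ then $ac+\varepsilon bd\in K_0$; (FR7) if $a+b(c+d)\in K_0$ then $a+bc+bd\in K_0$. A strong morphism $K\to L$ is a map $f:K\to L$ with $f(1)=1$, $f(0)=0$, $f(a\times b)=f(a)\times f(b)$ for all $a\in K^\times$, $b\in K$, and such that for all $a_i,b_i\in K$, if $\sum_{i=1}^n a_i\times b_i\in K_0$ then $\sum_{i=1}^n f(a_i)\times f(b_i)\in L_0$. Isomorphisms of fuzzy rings here are isomorphisms in the category of fuzzy rings and strong morphisms. **The hyperfield $H_\Gamma$.** Let $(\Gamma,\times)$ be a totally ordered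 abelian group. Adjoin an element $0$ to $\Gamma$ with $0<a$ for all $a\in\Gamma$, and $0$ absorbing for $\times$; $[0,x]=\{y\in\Gamma\cup\{0\}\mid 0\le y\le x\}$. $H_\Gamma$ is the set $\Gamma\cup\{0\}$ with this multiplication and the hyperaddition $x\oplus y=\{\max\{x,y\}\}$ if $x\ne y$, and $x\oplus x=[0,x]$. It is a hyperfield (a set with single-valued commutative multiplication, multivalued addition forming a canonical hypergroup, distributivity, and nonzero elements forming a group), and it is doubly-distributive: $(a\oplus b)(c\oplus d)=ac\oplus ad\oplus bc\oplus bd$. **The fuzzy ring $\overline{\mathcal{F}}(H)$.** For a doubly-distributive hyperfield $H$ with hyperaddition $+$, let $S(H)$ be the set of all subsets of $H$ of the form $\sum_{i=1}^n a_i$ (finite hypersums, $a_i\in H$, $n\ge1$). $\overline{\mathcal{F}}(H)$ is the fuzzy ring with underlying set $S(H)$, $A+B=\bigcup_{a\in A,b\in B}(a+b)$, $A\times B=\{ab\mid a\in A,b\in B\}$, $\varepsilon=\{-1_H\}$ (where $-1_H$ is the unique element with $0\in 1_H+(-1_H)$), $0=\{0_H\}$, $1=\{1_H\}$, null set $\{A\in S(H)\mid 0_H\in A\}$. **The fuzzy ring $K_\Gamma$.** $K_\Gamma$ is the set of all singletons and all intervals $[0,a]$ in $\Gamma\cup\{0\}$. Multiplication $\boxtimes$ is elementwise multiplication of subsets. Addition $\boxplus$ is commutative and given by: $\{a\}\boxplus\{b\}=\{\max\{a,b\}\}$ if $a\neq b$; $\{a\}\boxplus\{a\}=[0,a]$;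 $\{a\}\boxplus[0,b]=[0,b]$ if $a\le b$; $\{a\}\boxplus[0,b]=\{a\}$ if $b<a$; $[0,a]\boxplus[0,b]=[0,\max\{a,b\}]$. The null elements are the members of $K_\Gamma$ containing $0$, and $\varepsilon$ is the singleton consisting of the identity of $\Gamma$. *)

(* Defs.v *)
From HB Require Import structures.
From mathcomp Require Import all_boot all_order.
From mathcomp Require Import boolp classical_sets.

Set Implicit Arguments.
Unset Strict Implicit.
Unset Printing Implicit Defensive.

Import Order.TTheory.
Local Open Scope order_scope.
Local Open Scope classical_set_scope.

Definition invertible (T : Type) (mul : T -> T -> T) (one a : T) : Prop :=
  exists b, mul a b = one.

Record fuzzyRing := FuzzyRing {
  fuzzy_sort :> Type;
  fadd : fuzzy_sort -> fuzzy_sort -> fuzzy_sort;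
  fmul : fuzzy_sort -> fuzzy_sort -> fuzzy_sort;
  fzero : fuzzy_sort;
  fone : fuzzy_sort;
  feps : fuzzy_sort;
  fnull : set fuzzy_sort;
  faddA : associative fadd;
  faddC : commutative fadd;
  fadd0 : left_id fzero fadd;
  fmulA : associative fmul;
  fmulC : commutative fmul;
  fmul1 : left_id fone fmul;
  fmul0 : left_zero fzero fmul;
  fmulDr : forall a b c, invertible fmul fone a ->
    fmul a (fadd b c) = fadd (fmul a b) (fmul a c);
  feps2 : fmul feps feps = fone;
  fnullD : forall a b, fnull a -> fnull b -> fnull (fadd a b);
  fnullM : forall a b, fnull b -> fnull (fmul a b);
  fnull0 : fnull fzero;
  fnull1 : ~ fnull fone;
  fnull1D : forall a, invertible fmul fone a ->
    (fnull (fadd fone a) <-> a = feps);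
  fnullMM : forall a b c d, fnull (fadd a b) -> fnull (fadd c d) ->
    fnull (fadd (fmul a c) (fmul feps (fmul b d)));
  fnull_dist : forall a b c d, fnull (fadd a (fmul b (fadd c d))) ->
    fnull (fadd (fadd a (fmul b c)) (fmul b d))
}.

Record strong_morphism (K L : fuzzyRing) (f : K -> L) : Prop := StrongMorphism {
  strong_morphism1 : f (fone K) = fone L;
  strong_morphism0 : f (fzero K) = fzero L;
  strong_morphismM : forall a b : K, invertible (@fmul K) (fone K) a ->
    f (fmul a b) = fmul (f a) (f b);
  strong_morphism_null : forall (n : nat) (a b : 'I_n -> K),
    fnull (\big[@fadd K/fzero K]_(i < n) fmul (a i) (b i)) ->
    fnull (\big[@fadd L/fzero L]_(i < n) fmul (f (a i)) (f (b i)))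
}.

Record fuzzyIso (K L : fuzzyRing) := FuzzyIso {
  fuzzy_iso :> K -> L;
  fuzzy_iso_inv : L -> K;
  fuzzy_iso_strong : strong_morphism fuzzy_iso;
  fuzzy_iso_inv_strong : strong_morphism fuzzy_iso_inv;
  fuzzy_isoK : cancel fuzzy_iso fuzzy_iso_inv;
  fuzzy_iso_invK : cancel fuzzy_iso_inv fuzzy_iso
}.

(* [haddN] packages both the existence and the uniqueness of the opposite, and
   [hadd_rev] is the reversibility axiom of canonical hypergroups. *)
Record hyperfield := Hyperfield {
  hyper_sort :> Type;
  hadd : hyper_sort -> hyper_sort -> set hyper_sort;
  hmul : hyper_sort -> hyper_sort -> hyper_sort;
  hzero : hyper_sort;
  hone : hyper_sort;
  hopp : hyper_sort -> hyper_sort;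
  hadd_neq0 : forall x y, hadd x y !=set0;
  haddC : commutative hadd;
  haddA : forall x y z,
    \bigcup_(t in hadd y z) hadd x t = \bigcup_(t in hadd x y) hadd t z;
  hadd0 : forall x, hadd hzero x = [set x];
  haddN : forall x y, hadd x y hzero <-> y = hopp x;
  hadd_rev : forall x y z, hadd x y z -> hadd z (hopp x) y;
  hmulA : associative hmul;
  hmulC : commutative hmul;
  hmul1 : left_id hone hmul;
  hmul0 : left_zero hzero hmul;
  hmulDr : forall a x y,
    [set hmul a t | t in hadd x y] = hadd (hmul a x) (hmul a y);
  hone_neq0 : hone <> hzero;
  hmulV : forall x, x <> hzero -> exists y, hmul x y = hone
}.

Section Sumset.
Variable H : hyperfield.
Implicit Types (A B C : set H) (a b c d x y z : H) (s : seq H).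

Definition setadd A B : set H := \bigcup_(a in A) \bigcup_(b in B) hadd a b.

Definition setmul A B : set H := [set hmul a b | a in A & b in B].

(* The hypersum of the nonempty sequence [a :: s]. *)
Fixpoint hypersum a s : set H :=
  if s is b :: s' then setadd [set a] (hypersum b s') else [set a].

Definition sumset A : Prop := exists a s, A = hypersum a s.

Definition doubly_distributive : Prop := forall a b c d,
  setmul (hadd a b) (hadd c d) =
  hypersum (hmul a c) [:: hmul a d; hmul b c; hmul b d].

Lemma setaddP A B z :
  setadd A B z <-> exists a b, [/\ A a, B b & hadd a b z].
Proof.
split=> [[a Aa [b Bb abz]]|[a [b [Aa Bb abz]]]]; first by exists a, b.
by exists a => //; exists b.
Qed.

Lemma setadd1 a b : setadd [set a] [set b] = hadd a b.
Proof. by rewrite /setadd !bigcup_set1. Qed.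

Lemma setaddC : commutative setadd.
Proof.
by move=> A B; apply/seteqP; split=> z /setaddP[a [b [? ? ?]]]; apply/setaddP;
   exists b, a; rewrite haddC.
Qed.

Lemma setaddA : associative setadd.
Proof.
move=> A B C; apply/seteqP; split=> z /setaddP.
- case=> a [t [Aa /setaddP[b [c [Bb Cc tbc]]] zat]].
  have : (\bigcup_(t in hadd b c) hadd a t) z by exists t.
  rewrite haddA => -[u uab zuc]; apply/setaddP; exists u, c; split=> //.
  by apply/setaddP; exists a, b.
- case=> t [c [/setaddP[a [b [Aa Bb tab]]] Cc ztc]].
  have : (\bigcup_(t in hadd a b) hadd t c) z by exists t.
  rewrite -haddA => -[u ubc zau]; apply/setaddP; exists a, u; split=> //.
  by apply/setaddP; exists b, c.
Qed.

Lemma setadd0 : left_id [set hzero H] setadd.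
Proof.
move=> A; rewrite /setadd bigcup_set1; apply/seteqP; split=> z.
  by case=> a Aa; rewrite hadd0 => ->.
by move=> Az; exists z => //; rewrite hadd0.
Qed.

Lemma setmulC : commutative setmul.
Proof.
by move=> A B; apply/seteqP; split=> z [a Aa [b Bb <-]]; exists b => //;
   exists a => //; rewrite hmulC.
Qed.

Lemma setmulA : associative setmul.
Proof.
move=> A B C; apply/seteqP; split=> z.
- case=> a Aa [t [b Bb [c Cc <-]] <-]; exists (hmul a b); first by exists a => //; exists b.
  by exists c => //; rewrite hmulA.
- case=> t [a Aa [b Bb <-]] [c Cc <-]; exists a => //; exists (hmul b c).
    by exists b => //; exists c.
  by rewrite hmulA.
Qed.

Lemma setmul1 : left_id [set hone H] setmul.
Proof.
move=> A; apply/seteqP; split=> z; first by case=> _ -> [b Bb <-]; rewrite hmul1.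
by move=> Az; exists (hone H) => //; exists z => //; rewrite hmul1.
Qed.

Lemma setmul11 a b : setmul [set a] [set b] = [set hmul a b].
Proof.
apply/seteqP; split=> z; first by case=> _ -> [_ -> <-].
by move=> ->; exists a => //; exists b.
Qed.

Lemma setmulDr1 a B C : setmul [set a] (setadd B C) =
  setadd (setmul [set a] B) (setmul [set a] C).
Proof.
apply/seteqP; split=> z.
- case=> _ -> [t /setaddP[b [c [Bb Cc tbc]]] <-]; apply/setaddP.
  exists (hmul a b), (hmul a c); split; [by exists a => //; exists b
    |by exists a => //; exists c|].
  by rewrite -hmulDr; exists t.
- case/setaddP=> _ [_ [[_ -> [b Bb <-]] [_ -> [c Cc <-]]]].
  rewrite -hmulDr => -[t tbc <-]; exists a => //; exists t => //.
  by apply/setaddP; exists b, c.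
Qed.

Lemma sub_setmulDr A B C : setmul A (setadd B C) `<=`
  setadd (setmul A B) (setmul A C).
Proof.
move=> z [a Aa [t tBC <-]].
have : setmul [set a] (setadd B C) (hmul a t) by exists a => //; exists t.
rewrite setmulDr1 => /setaddP[x [y [[_ -> [b Bb <-]] [_ -> [c Cc <-]] xyz]]].
apply/setaddP; exists (hmul a b), (hmul a c); split=> //.
  by exists a => //; exists b.
by exists a => //; exists c.
Qed.

Lemma sumset1 a : sumset [set a]. Proof. by exists a, [::]. Qed.

Lemma hypersum_cat a b s t :
  hypersum a (s ++ b :: t) = setadd (hypersum a s) (hypersum b t).
Proof. by elim: s a => [//|c s IH] a /=; rewrite IH setaddA. Qed.

Lemma sumset_neq0 A : sumset A -> A !=set0.
Proof.
case=> a [s ->]; elim: s a => [|b s IH] a /=; first by exists a.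
have [y yP] := IH b; have [z zP] := hadd_neq0 a y.
by exists z; apply/setaddP; exists a, y.
Qed.

Lemma sumset_add A B : sumset A -> sumset B -> sumset (setadd A B).
Proof.
case=> a [s ->] [b [t ->]]; exists a, (s ++ b :: t).
by rewrite hypersum_cat.
Qed.

Lemma sumset_mul1 a B : sumset B -> sumset (setmul [set a] B).
Proof.
case=> b [s ->]; elim: s b => [|c s IH] b /=; first by rewrite setmul11; exact: sumset1.
by rewrite setmulDr1 setmul11; apply: sumset_add => //; exact: sumset1.
Qed.

Hypothesis dd : doubly_distributive.

Lemma setmulDl2 a b C : sumset C ->
  setmul (hadd a b) C = setadd (setmul [set a] C) (setmul [set b] C).
Proof.
case=> c [s ->]; elim: s c => [|d s IH] c.
  by rewrite /= -(setadd1 a b) setmulC setmulDr1 !(setmulC [set c]).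
have -> : setmul (hadd a b) (hypersum c (d :: s)) =
  \bigcup_(t in hypersum d s) setmul (hadd a b) (hadd c t).
  apply/seteqP; split=> z.
    case=> x xab [y /setaddP[_ [t [-> tds yct]]] <-]; exists t => //.
    by exists x => //; exists y.
  case=> t tds [x xab [y yct <-]]; exists x => //; exists y => //.
  by apply/setaddP; exists c, t.
have E t : setmul (hadd a b) (hadd c t) =
    setadd (hadd (hmul a c) (hmul b c)) (setmul (hadd a b) [set t]).
  rewrite dd /= -setadd1 -(setadd1 a b) [in RHS]setmulC setmulDr1 !setmul11.
  rewrite -!(hmulC t) -!setaddA; congr setadd.
  by rewrite ![setadd [set hmul t a] _]setaddC -!setaddA; congr setadd;
     rewrite setaddC.
under eq_bigcupr do rewrite E.
have -> : \bigcup_(t in hypersum d s)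
    setadd (hadd (hmul a c) (hmul b c)) (setmul (hadd a b) [set t]) =
  setadd (hadd (hmul a c) (hmul b c)) (setmul (hadd a b) (hypersum d s)).
  apply/seteqP; split=> z.
    case=> t tds /setaddP[x [y [xP [u uP [_ -> <-]] zP]]].
    by apply/setaddP; exists x, (hmul u t); split=> //; exists u => //; exists t.
  case/setaddP=> x [y [xP [u uP [t tds <-]] zP]]; exists t => //.
  by apply/setaddP; exists x, (hmul u t); split=> //; exists u => //; exists t.
rewrite IH /= !setmulDr1 !setmul11 -setadd1 -!setaddA; congr setadd.
by rewrite ![setadd (setmul [set a] _) _]setaddC -!setaddA; congr setadd;
   rewrite setaddC.
Qed.

Lemma sumset_mul A B : sumset A -> sumset B -> sumset (setmul A B).
Proof.
move=> [a [s ->]] SB; elim: s a => [|b s IH] a /=; first exact: sumset_mul1.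
suff -> : setmul (setadd [set a] (hypersum b s)) B =
    setadd (setmul [set a] B) (setmul (hypersum b s) B).
  by apply: sumset_add; [exact: sumset_mul1|exact: IH].
apply/seteqP; split=> z.
  by rewrite setmulC => /sub_setmulDr; rewrite !(setmulC B).
case/setaddP=> x [y [[_ -> [u Bu <-]] [t tP [v Bv <-]] zP]].
have : setmul (hadd a t) B z.
  rewrite setmulDl2 //; apply/setaddP; exists (hmul a u), (hmul t v); split=> //.
    by exists a => //; exists u.
  by exists t => //; exists v.
case=> w wP [k Bk <-]; exists w; last by exists k.
by apply/setaddP; exists a, t.
Qed.

Definition Fbar_sort : Type := {A : set H | sumset A}.

Lemma sumset_inj (X Y : Fbar_sort) : sval X = sval Y -> X = Y.
Proof.
case: X Y => [A SA] [B SB] /= eAB; subst B.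
by rewrite (Prop_irrelevance SA SB).
Qed.

Definition Fbar_add (X Y : Fbar_sort) : Fbar_sort := exist _ _ (sumset_add (svalP X) (svalP Y)).
Definition Fbar_mul (X Y : Fbar_sort) : Fbar_sort := exist _ _ (sumset_mul (svalP X) (svalP Y)).
Definition Fbar_one : Fbar_sort := exist _ _ (sumset1 (hone H)).

Lemma hmulI_unit a b c : hmul a b = hone H -> hmul a c = hone H -> b = c.
Proof.
move=> ab ac.
by rewrite -(hmul1 b) -ac (hmulC a c) -hmulA ab hmulC hmul1.
Qed.

Lemma Fbar_unit (X : Fbar_sort) : invertible Fbar_mul Fbar_one X -> exists a, sval X = [set a].
Proof.
case=> Y /(congr1 sval) /= XY.
have [b Yb] := sumset_neq0 (svalP Y); have [a Xa] := sumset_neq0 (svalP X).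
have XY1 x y : sval X x -> sval Y y -> hmul x y = hone H.
  move=> Xx Yy; have : setmul (sval X) (sval Y) (hmul x y) by exists x => //; exists y.
  by rewrite XY.
exists a; apply/seteqP; split=> z; last by move=> ->.
by move=> Xz; apply: (@hmulI_unit b); rewrite hmulC XY1.
Qed.

Lemma haddNN x : hadd x (hopp x) (hzero H).
Proof. by apply/haddN. Qed.

Lemma hmulN1 x : hmul (hopp (hone H)) x = hopp x.
Proof.
apply/haddN; rewrite hmulC -{1}(hmul1 x) (hmulC _ x) -hmulDr.
by exists (hzero H); [exact: haddNN|rewrite hmulC hmul0].
Qed.

Lemma hoppK : involutive (@hopp H).
Proof. by move=> x; apply/esym/haddN; rewrite haddC; apply/haddN. Qed.

Definition Fbar : fuzzyRing.
Proof.
refine (@FuzzyRing Fbar_sort Fbar_add Fbar_mul (exist _ _ (sumset1 (hzero H))) Fbar_one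
  (exist _ _ (sumset1 (hopp (hone H)))) [set X | sval X (hzero H)]
  _ _ _ _ _ _ _ _ _ _ _ _ _ _ _ _).
- by move=> X Y Z; apply: sumset_inj; exact: setaddA.
- by move=> X Y; apply: sumset_inj; exact: setaddC.
- by move=> X; apply: sumset_inj; exact: setadd0.
- by move=> X Y Z; apply: sumset_inj; exact: setmulA.
- by move=> X Y; apply: sumset_inj; exact: setmulC.
- by move=> X; apply: sumset_inj; exact: setmul1.
- move=> X; apply: sumset_inj => /=; apply/seteqP; split=> z.
    by case=> _ -> [b _ <-]; rewrite hmul0.
  have [x Xx] := sumset_neq0 (svalP X).
  by move=> ->; exists (hzero H) => //; exists x => //; rewrite hmul0.
- move=> X Y Z /Fbar_unit[a Xa]; apply: sumset_inj => /=.
  by rewrite Xa setmulDr1.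
- by apply: sumset_inj; rewrite /= setmul11 hmulN1 hoppK.
- move=> X Y /= X0 Y0; apply/setaddP; exists (hzero H), (hzero H).
  by rewrite hadd0.
- move=> X Y /= Y0; have [x Xx] := sumset_neq0 (svalP X).
  by exists x => //; exists (hzero H) => //; rewrite hmulC hmul0.
- by [].
- by move=> /= /esym /hone_neq0.
- move=> X /Fbar_unit[a Xa] /=; rewrite Xa setadd1; split.
    by move/haddN => ea; apply: sumset_inj; rewrite Xa ea.
  move=> /(congr1 sval) /=; rewrite Xa => /(congr1 (fun A => A a)) /= ea.
  by apply/haddN; rewrite -ea.
- move=> X Y Z T /setaddP[a [b [Xa Yb /haddN eb]]]
    /setaddP[c [d [Zc Td /haddN ed]]] /=.
  apply/setaddP; exists (hmul a c), (hmul (hopp (hone H)) (hmul b d)); split.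
  + by exists a => //; exists c.
  + by exists (hopp (hone H)) => //; exists (hmul b d) => //; exists b => //; exists d.
  + rewrite hmulN1; apply/haddN; congr hopp; rewrite eb ed.
    rewrite -(hmulN1 a) -(hmulN1 c) -hmulA (hmulC a) -hmulA (hmulC c).
    by rewrite !hmulN1 hoppK.
- move=> X Y Z T /= /setaddP[a [t [Xa tP at0]]].
  rewrite -setaddA; apply/setaddP; exists a, t; split=> //.
  exact: sub_setmulDr.
Defined.

Definition Fbar_set (X : Fbar) : set H := sval X.

End Sumset.

HB.mixin Record Total_Group_isOrderedAbelianGroup (d : Order.disp_t) G
    of Order.Total d G & Group G := {
  oagMC : commutative (@mul G);
  oag_le2r : forall a b c : G, a <= b -> (a * c)%g <= (b * c)%g
}.

#[short(type="orderedAbelianGroupType")]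
HB.structure Definition OrderedAbelianGroup (d : Order.disp_t) :=
  {G of Order.Total d G & Group G & Total_Group_isOrderedAbelianGroup d G}.

(* [G] with an adjoined element [None], absorbing for the product and smaller
   than every element of [G]. *)
Definition with_zero (G : Type) : Type := option G.

Section WithZero.
Variables (d : Order.disp_t) (G : orderedAbelianGroupType d).

Definition le0 (x y : with_zero G) : bool :=
  match x, y with
  | None, _ => true
  | Some _, None => false
  | Some a, Some b => a <= b
  end.

Definition lt0 (x y : with_zero G) : bool := (y != x :> option G) && le0 x y.

Lemma le0_anti : antisymmetric le0.
Proof. by case=> [a|] [b|] //= /le_anti ->. Qed.

Lemma le0_trans : transitive le0.
Proof. by case=> [a|] [b|] [c|] //=; exact: le_trans. Qed.

Lemma le0_total : total le0.
Proof. by case=> [a|] [b|] //=; exact: le_total. Qed.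

HB.instance Definition _ := Choice.copy (with_zero G) (option G).
HB.instance Definition _ := Order.isOrder.Build d (with_zero G)
  (fun _ _ => erefl) (fun _ _ => erefl) (fun _ _ => erefl)
  le0_anti le0_trans le0_total.

Definition zero0 : with_zero G := None.
Definition one0 : with_zero G := Some 1%g.

Definition mul0 (x y : with_zero G) : with_zero G :=
  if x is Some a then if y is Some b then Some (a * b)%g else None else None.

Implicit Types x y z : with_zero G.

Lemma le_0x x : zero0 <= x. Proof. by []. Qed.

Lemma lt_0x x : (zero0 < x) = (x != zero0).
Proof. by rewrite lt_neqAle le_0x andbT eq_sym. Qed.

Lemma le_x0 x : (x <= zero0) = (x == zero0).
Proof. by case: x. Qed.

Lemma mul0A : associative mul0.
Proof. by case=> [a|] [b|] [c|] //=; rewrite mulgA. Qed.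

Lemma mul0C : commutative mul0.
Proof. by case=> [a|] [b|] //=; rewrite oagMC. Qed.

Lemma mul01 : left_id one0 mul0.
Proof. by case=> [a|] //=; rewrite mul1g. Qed.

Lemma mul00 : left_zero zero0 mul0. Proof. by []. Qed.

Lemma mul0_eq0 x y : (mul0 x y == zero0) = (x == zero0) || (y == zero0).
Proof. by case: x y => [a|] [b|]. Qed.

Lemma mul0V x : x != zero0 -> exists y, mul0 x y = one0.
Proof. by case: x => [a|//] _; exists (Some a^-1%g); rewrite /= mulgV. Qed.

Lemma le_mul0r z x y : x <= y -> mul0 x z <= mul0 y z.
Proof.
case: x y z => [a|] [b|] [c|] //; rewrite /Order.le /=; exact: oag_le2r.
Qed.

Lemma le_mul0l z x y : x <= y -> mul0 z x <= mul0 z y.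
Proof. by rewrite ![mul0 z _]mul0C; exact: le_mul0r. Qed.

Lemma mul0I z : z != zero0 -> injective (mul0 z).
Proof.
move=> /mul0V[w zw] x y e.
by rewrite -(mul01 x) -zw -mul0A (mul0C w) mul0A e -mul0A (mul0C y) mul0A zw mul01.
Qed.

Lemma lt_mul0l z x y : z != zero0 -> x < y -> mul0 z x < mul0 z y.
Proof.
move=> z0; rewrite !lt_neqAle => /andP[xy /(le_mul0l z) ->]; rewrite andbT.
by apply: contra_neq xy => /(mul0I z0).
Qed.

Lemma lt_mul0r z x y : z != zero0 -> x < y -> mul0 x z < mul0 y z.
Proof. by rewrite ![mul0 _ z]mul0C; exact: lt_mul0l. Qed.

Definition itv0 (x : with_zero G) : set (with_zero G) := [set y | zero0 <= y <= x].

Lemma itv0E x y : itv0 x y = (y <= x). Proof. by []. Qed.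

Lemma itv0_0 : itv0 zero0 = [set zero0].
Proof.
by apply/seteqP; split=> y; rewrite itv0E le_x0 => /eqP.
Qed.

Lemma mul0_itv x y : [set mul0 x t | t in itv0 y] = itv0 (mul0 x y).
Proof.
apply/seteqP; split=> z; first by case=> t; rewrite !itv0E => ty <-; exact: le_mul0l.
rewrite itv0E; have [->|x0] := eqVneq x zero0.
  by rewrite mul00 le_x0 => /eqP ->; exists zero0; rewrite ?itv0E.
have [w xw] := mul0V x0 => zxy; exists (mul0 w z); last by rewrite mul0A xw mul01.
rewrite itv0E; have := le_mul0l w zxy.
by rewrite mul0A (mul0C w x) xw mul01.
Qed.

Definition HGamma_add (x y : with_zero G) : set (with_zero G) :=
  if x == y then itv0 x else [set Order.max x y].

Lemma HGamma_addC : commutative HGamma_add.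
Proof. by move=> x y; rewrite /HGamma_add eq_sym maxC; case: eqP => [->|]. Qed.

Lemma HGamma_add_lt x y : x < y -> HGamma_add x y = [set y].
Proof. by move=> xy; rewrite /HGamma_add lt_eqF// max_r// ltW. Qed.

Lemma HGamma_addxx x : HGamma_add x x = itv0 x.
Proof. by rewrite /HGamma_add eqxx. Qed.

Lemma HGamma_addP x y z : HGamma_add x y z <->
  [\/ x = y /\ z <= x, z = x /\ y <= x | z = y /\ x <= y].
Proof.
case: (ltgtP x y) => [xy|yx|<-].
- rewrite HGamma_add_lt//; split=> [->|]; first by apply: Or33.
  by case=> [[e]|[]//|[]//]; rewrite e ltxx in xy.
- rewrite HGamma_addC HGamma_add_lt//; split=> [->|]; first by apply: Or32.
  by case=> [[e]|[]//|[]//]; rewrite e ltxx in yx.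
- by rewrite HGamma_addxx itv0E; split=> [zx|[[]|[->]|[->]]//]; apply: Or31.
Qed.

Lemma HGamma_addA_sub x y z :
  \bigcup_(t in HGamma_add y z) HGamma_add x t `<=`
  \bigcup_(t in HGamma_add x y) HGamma_add t z.
Proof.
move=> w [t /HGamma_addP tyz /HGamma_addP wxt].
case: (ltgtP x y) => [xy|yx|exy].
- exists y; first by rewrite HGamma_add_lt.
  apply/HGamma_addP; case: wxt => [[ext wx]|[-> tx]|[-> _]].
  + case: tyz => [[<- _]|[e _]|[e yz]]; first by apply: Or31; split=> //; exact: le_trans wx (ltW xy).
      by move: xy; rewrite ext e ltxx.
    by move: xy; rewrite ext e ltNge yz.
  + case: tyz => [[<- _]|[e _]|[e yz]]; first by apply: Or31; split=> //; rewrite ltW.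
      by move: xy; rewrite -e ltNge tx.
    by move: tx; rewrite e => /(le_trans yz); rewrite leNgt xy.
  + exact: tyz.
- exists x; first by rewrite HGamma_addC HGamma_add_lt.
  apply/HGamma_addP; case: wxt => [[ext wx]|[-> tx]|[-> xt]].
  + case: tyz => [[_ ty]|[e _]|[e _]].
    * by move: yx; rewrite ext ltNge ty.
    * by move: yx; rewrite ext e ltxx.
    * by apply: Or31; rewrite -e.
  + apply: Or32; split=> //; case: tyz => [[<- _]|[_ zy]|[<- _]] //; first exact: ltW.
    exact: le_trans zy (ltW yx).
  + case: tyz => [[_ ty]|[e _]|[e _]].
    * by move: (le_trans xt ty); rewrite leNgt yx.
    * by move: yx; rewrite -e ltNge xt.
    * by apply: Or33; rewrite -e.
- subst y; have [<-|wz] := eqVneq w z.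
    exists zero0; first by rewrite HGamma_addxx.
    by apply/HGamma_addP; apply: Or33.
  have zx : z <= x.
    rewrite leNgt; apply/negP => xz; case: tyz => [[e _]|[_ zx]|[e _]].
    + by move: xz; rewrite e ltxx.
    + by move: xz; rewrite ltNge zx.
    + case: wxt => [[e' _]|[_ tx]|[e' _]].
      * by move: xz; rewrite e' e ltxx.
      * by move: xz; rewrite -e ltNge tx.
      * by move: wz; rewrite e' e eqxx.
  have tx : t <= x by case: tyz => [[//]|[->]|[->]].
  have wx : w <= x by case: wxt => [[//]|[->]|[->]].
  exists (Order.max w z); first by rewrite HGamma_addxx itv0E ge_max wx zx.
  apply/HGamma_addP; case: (ltgtP w z) wz => // [wz|zw] _.
    by apply: Or31; split=> //; exact: ltW.
  by apply: Or32; split=> //; exact: ltW.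
Qed.

Lemma HGamma_addA x y z :
  \bigcup_(t in HGamma_add y z) HGamma_add x t =
  \bigcup_(t in HGamma_add x y) HGamma_add t z.
Proof.
apply/seteqP; split; first exact: HGamma_addA_sub.
have -> : \bigcup_(t in HGamma_add x y) HGamma_add t z =
    \bigcup_(t in HGamma_add y x) HGamma_add z t.
  by rewrite HGamma_addC; apply: eq_bigcupr => t _; exact: HGamma_addC.
suff -> : \bigcup_(t in HGamma_add y z) HGamma_add x t =
    \bigcup_(t in HGamma_add z y) HGamma_add t x by exact: HGamma_addA_sub.
by rewrite HGamma_addC; apply: eq_bigcupr => t _; exact: HGamma_addC.
Qed.

Lemma HGamma_addN x y : HGamma_add x y zero0 <-> y = x.
Proof.
rewrite HGamma_addP; split=> [|->]; last by apply: Or31.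
by case=> [[->]//|[<-]|[<-]]; rewrite le_x0 => /eqP.
Qed.

Lemma HGamma_add_rev x y z : HGamma_add x y z -> HGamma_add z x y.
Proof.
move/HGamma_addP=> h; apply/HGamma_addP.
by case: h => [[-> ?]|[-> ?]|[-> ?]]; [apply: Or33|apply: Or31|apply: Or32].
Qed.

Lemma HGamma_mulDr a x y :
  [set mul0 a t | t in HGamma_add x y] = HGamma_add (mul0 a x) (mul0 a y).
Proof.
have [->|a0] := eqVneq a zero0.
  rewrite !mul00 HGamma_addxx itv0_0; apply/seteqP; split=> z; first by case.
  move=> ->; exists (Order.max x y) => //; apply/HGamma_addP.
  by case: (leP x y) => xy; [apply: Or33|apply: Or32; split=> //; exact: ltW].
wlog xy : x y / x <= y.
  by move=> W; case/orP: (le_total x y) => /W//; rewrite HGamma_addC => ->; rewrite HGamma_addC.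
move: xy; rewrite le_eqVlt => /predU1P[<-|xy].
  by rewrite !HGamma_addxx mul0_itv.
by rewrite !HGamma_add_lt ?lt_mul0l// image_set1.
Qed.

Definition HGamma : hyperfield.
Proof.
refine (@Hyperfield (with_zero G) HGamma_add mul0 zero0 one0 id
  _ HGamma_addC HGamma_addA _ HGamma_addN HGamma_add_rev
  mul0A mul0C mul01 mul00 HGamma_mulDr _ _).
- move=> x y; exists (Order.max x y); apply/HGamma_addP.
  by case: (leP x y) => xy; [apply: Or33|apply: Or32; split=> //; exact: ltW].
- move=> x; have [->|x0] := eqVneq x zero0; first by rewrite HGamma_addxx itv0_0.
  by rewrite HGamma_add_lt// lt_0x.
- by [].
- by move=> x /eqP; exact: mul0V.
Defined.

Lemma HGamma_add1_itv x y : x <= y -> @setadd HGamma [set x] (itv0 y) = itv0 y.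
Proof.
move=> xy; apply/seteqP; split=> z.
  case/setaddP=> _ [t [-> ty /HGamma_addP]]; rewrite itv0E in ty *.
  by case=> [[_ zx]|[-> _]|[-> _]] //; exact: le_trans xy.
rewrite itv0E => zy; apply/setaddP; have [zx|xz] := leP z x.
  by exists x, x; rewrite itv0E; split=> //; apply/HGamma_addP; apply: Or31.
by exists x, z; rewrite itv0E; split=> //; apply/HGamma_addP; apply: Or33; split=> //; exact: ltW.
Qed.

Lemma HGamma_add1_itv_lt x y : y < x -> @setadd HGamma [set x] (itv0 y) = [set x].
Proof.
move=> yx; apply/seteqP; split=> z.
  case/setaddP=> _ [t [-> ty]]; rewrite itv0E in ty *.
  by rewrite /= HGamma_addC HGamma_add_lt//; exact: le_lt_trans yx.
move=> ->; apply/setaddP; exists x, y; rewrite itv0E; split=> //=.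
by rewrite HGamma_addC HGamma_add_lt.
Qed.

Lemma HGamma_mul_set1 x (A : set (with_zero G)) :
  @setmul HGamma [set x] A = [set mul0 x t | t in A].
Proof.
apply/seteqP; split=> z; first by case=> _ -> [t At <-]; exists t.
by case=> t At <-; exists x => //; exists t.
Qed.

Lemma HGamma_mul_itv x y : @setmul HGamma (itv0 x) (itv0 y) = itv0 (mul0 x y).
Proof.
apply/seteqP; split=> z.
  case=> t tx [u uy <-]; rewrite itv0E in tx uy *.
  exact: le_trans (le_mul0r u tx) (le_mul0l x uy).
rewrite -mul0_itv => -[t ty <-]; exists x; last by exists t.
by rewrite itv0E.
Qed.

Lemma HGamma_dd : doubly_distributive HGamma.
Proof.
have sum4 (H : hyperfield) (x y z t : H) :
    hypersum x [:: y; z; t] = setadd (hadd x y) (hadd z t).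
  by rewrite /= -!setadd1 !setaddA.
suff main a b c e : a <= b -> c <= e -> @setmul HGamma (HGamma_add a b) (HGamma_add c e) =
    @hypersum HGamma (mul0 a c) [:: mul0 a e; mul0 b c; mul0 b e].
  have main2 a b c e : a <= b -> @setmul HGamma (HGamma_add a b) (HGamma_add c e) =
    @hypersum HGamma (mul0 a c) [:: mul0 a e; mul0 b c; mul0 b e].
    move=> ab; case/orP: (le_total c e) => [/(main _ _ _ _ ab)//|].
    move=> /(main _ _ _ _ ab); rewrite !sum4 (HGamma_addC e c) => ->.
    by congr setadd; exact: HGamma_addC.
  move=> a b c e; case/orP: (le_total a b) => [/(main2 _ _ c e)//|].
  by move=> /(main2 _ _ c e); rewrite !sum4 setaddC (HGamma_addC b a) => ->.
rewrite [a <= b]le_eqVlt [c <= e]le_eqVlt => /predU1P[<-|ab] /predU1P[<-|ce].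
- rewrite !HGamma_addxx HGamma_mul_itv /= setadd1 [hadd _ _]HGamma_addxx.
  by rewrite !HGamma_add1_itv.
- rewrite HGamma_addxx (HGamma_add_lt ce) setmulC HGamma_mul_set1 mul0_itv mul0C /=.
  rewrite setadd1 /=; have [->|a0] := eqVneq a zero0.
    by rewrite !mul00 HGamma_addxx !HGamma_add1_itv.
  rewrite HGamma_add_lt ?lt_mul0l// setadd1 /= HGamma_addxx HGamma_add1_itv//.
  by rewrite le_mul0l// ltW.
- rewrite HGamma_addxx (HGamma_add_lt ab) HGamma_mul_set1 mul0_itv /=.
  by rewrite setadd1 /= HGamma_addxx !HGamma_add1_itv// le_mul0r// ltW.
- have b0 : b != zero0 by rewrite -lt_0x (le_lt_trans _ ab).
  have e0 : e != zero0 by rewrite -lt_0x (le_lt_trans _ ce).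
  rewrite (HGamma_add_lt ab) (HGamma_add_lt ce) HGamma_mul_set1 image_set1 /=.
  rewrite setadd1 /= (HGamma_add_lt (lt_mul0l b0 ce)) setadd1 /=.
  rewrite (HGamma_add_lt (lt_mul0r e0 ab)) setadd1 /= HGamma_add_lt//.
  exact: le_lt_trans (le_mul0r c (ltW ab)) (lt_mul0l b0 ce).
Qed.

Inductive shape := Single of with_zero G | Interval of with_zero G.

Definition shape_set (u : shape) : set (with_zero G) :=
  match u with Single a => [set a] | Interval a => itv0 a end.

Definition shape_add (u v : shape) : shape :=
  match u, v with
  | Single a, Single b => if a == b then Interval a else Single (Order.max a b)
  | Single a, Interval b | Interval b, Single a =>
      if a <= b then Interval b else Single a
  | Interval a, Interval b => Interval (Order.max a b)
  end.

Definition KGamma_sort : Type :=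
  {A : set (with_zero G) | exists u, A = shape_set u}.

Definition KGamma_of (u : shape) : KGamma_sort :=
  exist _ (shape_set u) (ex_intro _ u erefl).

(* [set zero0] = [itv0 zero0] is the only element with two shapes; by
   [KGamma_addE], the choice made here does not affect the sum. *)
Definition shape_of (A : KGamma_sort) : shape := sval (cid (svalP A)).

Definition KGamma_add (A B : KGamma_sort) : KGamma_sort :=
  KGamma_of (shape_add (shape_of A) (shape_of B)).

Lemma KGamma_inj (A B : KGamma_sort) : sval A = sval B -> A = B.
Proof.
case: A B => [A SA] [B SB] /= eAB; subst B.
by rewrite (Prop_irrelevance SA SB).
Qed.

Lemma shape_ofK A : KGamma_of (shape_of A) = A.
Proof. by apply: KGamma_inj => /=; rewrite /shape_of; case: cid. Qed.

Definition shape_top (u : shape) : with_zero G := match u with Single a | Interval a => a end.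
Definition shape_isitv (u : shape) : bool := if u is Interval _ then true else false.

Lemma shape_add_topE u v : shape_add u v =
  if shape_top u < shape_top v then v else if shape_top v < shape_top u then u else Interval (shape_top u).
Proof.
by case: u v => [a|a] [b|b] /=; case: (ltgtP a b) => // ->.
Qed.

Lemma shape_set_eq u v : shape_set u = shape_set v ->
  u = v \/ shape_top u = zero0 /\ shape_top v = zero0.
Proof.
have st w : shape_set w (shape_top w) by case: w => a //=; rewrite itv0E.
have le_st w x : shape_set w x -> x <= shape_top w.
  by case: w => a /=; [move=> ->|rewrite itv0E].
move=> e; have tuv : shape_top u = shape_top v.
  by apply/le_anti/andP; split; apply: le_st; rewrite -?e// e.
have s0 a : [set a] = itv0 a -> a = zero0.
  move=> /(congr1 (fun A => A zero0)) /= e0.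
  by have : zero0 = a by rewrite e0 itv0E.
case: u v e tuv => [a|a] [b|b] /= e eab; subst b; try by left.
  by right; split; exact: s0.
by right; split; apply: s0; rewrite e.
Qed.

Lemma shape_set_addl u u' v : shape_set u = shape_set u' ->
  shape_set (shape_add u v) = shape_set (shape_add u' v).
Proof.
move=> /shape_set_eq[->//|[tu tu']]; rewrite !shape_add_topE tu tu'.
by case: ifP => // _; rewrite lt_neqAle le_x0; case: eqP.
Qed.

Lemma shape_addC : commutative shape_add.
Proof.
by move=> u v; rewrite !shape_add_topE; case: (ltgtP (shape_top u) (shape_top v)) => // ->.
Qed.

Lemma KGamma_addE u v :
  KGamma_add (KGamma_of u) (KGamma_of v) = KGamma_of (shape_add u v).
Proof.
apply: KGamma_inj => /=; rewrite (@shape_set_addl _ u).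
  by rewrite !(shape_addC u); apply: shape_set_addl; rewrite /shape_of; case: cid.
by rewrite /shape_of; case: cid.
Qed.

Definition shape_mul (u v : shape) : shape :=
  (if shape_isitv u || shape_isitv v then Interval else Single)
  (mul0 (shape_top u) (shape_top v)).

Lemma shape_set_mul u v : [set mul0 x y | x in shape_set u & y in shape_set v] =
  shape_set (shape_mul u v).
Proof.
change (@setmul HGamma (shape_set u) (shape_set v) = shape_set (shape_mul u v)).
case: u v => [a|a] [b|b]; rewrite /shape_mul /=.
- by rewrite HGamma_mul_set1 image_set1.
- by rewrite HGamma_mul_set1 mul0_itv.
- by rewrite setmulC HGamma_mul_set1 mul0_itv mul0C.
- exact: HGamma_mul_itv.
Qed.

Lemma KGamma_mul_subproof (A B : KGamma_sort) :
  exists u, [set mul0 x y | x in sval A & y in sval B] = shape_set u.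
Proof.
exists (shape_mul (shape_of A) (shape_of B)); rewrite -shape_set_mul.
by move: (congr1 sval (shape_ofK A)) (congr1 sval (shape_ofK B)) => /= -> ->.
Qed.

Definition KGamma_mul (A B : KGamma_sort) : KGamma_sort :=
  exist _ [set mul0 x y | x in sval A & y in sval B] (KGamma_mul_subproof A B).

Definition KGamma_zero : KGamma_sort := KGamma_of (Single zero0).
Definition KGamma_one : KGamma_sort := KGamma_of (Single one0).
Definition KGamma_null : set KGamma_sort := [set A | sval A zero0].

Lemma KGamma_mulE u v :
  KGamma_mul (KGamma_of u) (KGamma_of v) = KGamma_of (shape_mul u v).
Proof. by apply: KGamma_inj; exact: shape_set_mul. Qed.

Lemma KGamma_nullE u :
  KGamma_null (KGamma_of u) <-> shape_isitv u || (shape_top u == zero0).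
Proof.
by case: u => a /=; split=> //; [move=> ->|move=> /eqP ->].
Qed.

Lemma KGamma_itv0 : KGamma_of (Interval zero0) = KGamma_zero.
Proof. by apply: KGamma_inj; rewrite /= itv0_0. Qed.

Lemma KGamma_top0 u : shape_top u = zero0 -> KGamma_of u = KGamma_zero.
Proof. by case: u => a /= ->; rewrite ?KGamma_itv0. Qed.

Lemma shape_addA : associative shape_add.
Proof.
move=> u v w; rewrite !shape_add_topE.
case: (ltgtP (shape_top v) (shape_top w)) => vw; case: (ltgtP (shape_top u) (shape_top v)) => uv /=;
  rewrite ?vw ?uv ?ltxx ?(lt_trans uv vw) ?(lt_gtF vw) ?(lt_gtF uv) //.
- by move: (lt_trans vw uv) => wu; rewrite (lt_gtF wu) wu.
- by rewrite if_same.
- by rewrite -vw uv (lt_gtF uv).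
- by rewrite vw ltxx.
Qed.

Lemma shape_mulA : associative shape_mul.
Proof.
by case=> [a|a] [b|b] [c|c]; rewrite /shape_mul /= mul0A.
Qed.

Lemma shape_mulC : commutative shape_mul.
Proof. by case=> [a|a] [b|b]; rewrite /shape_mul /= mul0C. Qed.

Lemma shape_mul1 : left_id (Single one0) shape_mul.
Proof. by case=> a; rewrite /shape_mul [mul0 _ _]mul01. Qed.

Lemma top_mul u v : shape_top (shape_mul u v) = mul0 (shape_top u) (shape_top v).
Proof. by case: u v => [a|a] [b|b]. Qed.

Lemma isitv_mul u v : shape_isitv (shape_mul u v) = shape_isitv u || shape_isitv v.
Proof. by case: u v => [a|a] [b|b]. Qed.

Lemma KGamma_mulDr A B C : KGamma_mul A (KGamma_add B C) =
  KGamma_add (KGamma_mul A B) (KGamma_mul A C).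
Proof.
rewrite -(shape_ofK A) -(shape_ofK B) -(shape_ofK C).
move: (shape_of A) (shape_of B) (shape_of C) => {A B C} u v w.
rewrite KGamma_addE !KGamma_mulE KGamma_addE.
have [u0|u0] := eqVneq (shape_top u) zero0.
  rewrite !KGamma_top0// ?top_mul ?u0 ?mul00//.
  by rewrite shape_add_topE !top_mul u0 !mul00 ltxx.
congr KGamma_of; rewrite !shape_add_topE !top_mul.
case: (ltgtP (shape_top v) (shape_top w)) => vw.
- by rewrite lt_mul0l.
- by rewrite lt_gtF ?lt_mul0l.
- by rewrite vw ltxx /shape_mul orbT.
Qed.

Lemma KGamma_unit u : invertible KGamma_mul KGamma_one (KGamma_of u) ->
  exists2 a, u = Single a & a != zero0.
Proof.
case=> B; rewrite -(shape_ofK B) KGamma_mulE => e.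
have : ~ KGamma_null (KGamma_of (shape_mul u (shape_of B))) by rewrite e.
move/KGamma_nullE; rewrite isitv_mul top_mul mul0_eq0.
by case: u {e} => a /=; [move=> n; exists a => //; apply: contra_notN n => ->|]; 
  rewrite ?orbT.
Qed.

Lemma shape_add_null u v :
  shape_isitv (shape_add u v) || (shape_top (shape_add u v) == zero0) <->
  [\/ shape_top u = shape_top v, (shape_top u < shape_top v) /\ shape_isitv v | (shape_top v < shape_top u) /\ shape_isitv u].
Proof.
rewrite shape_add_topE; case: (ltgtP (shape_top u) (shape_top v)) => uv.
- have /negbTE -> : shape_top v != zero0 by rewrite -lt_0x (le_lt_trans _ uv).
  rewrite orbF; split=> [vi|[e|[]//|[]//]]; first by apply: Or32.
  by rewrite e ltxx in uv.
- have /negbTE -> : shape_top u != zero0 by rewrite -lt_0x (le_lt_trans _ uv).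
  rewrite orbF; split=> [vi|[e|[]//|[]//]]; first by apply: Or33.
  by rewrite e ltxx in uv.
- by split=> // _; apply: Or31.
Qed.

Lemma shape_add_null_le u v : shape_top u <= shape_top v -> shape_isitv v ->
  shape_isitv (shape_add u v) || (shape_top (shape_add u v) == zero0).
Proof.
rewrite le_eqVlt => /predU1P[uv|uv] vi; apply/shape_add_null; first by apply: Or31.
by apply: Or32.
Qed.

Lemma KGamma_nullMM A B C D : KGamma_null (KGamma_add A B) ->
  KGamma_null (KGamma_add C D) ->
  KGamma_null (KGamma_add (KGamma_mul A C) (KGamma_mul B D)).
Proof.
rewrite -(shape_ofK A) -(shape_ofK B) -(shape_ofK C) -(shape_ofK D).
move: (shape_of A) (shape_of B) (shape_of C) (shape_of D) => {A B C D} a b c e.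
rewrite !KGamma_mulE !KGamma_addE => /KGamma_nullE ab /KGamma_nullE ce.
apply/KGamma_nullE; move: ab ce.
wlog ab : a b c e / shape_top a <= shape_top b.
  move=> W; case/orP: (le_total (shape_top a) (shape_top b)); first exact: W.
  by rewrite (shape_addC a) (shape_addC c) [shape_add (shape_mul a c) _]shape_addC;
     exact: W.
have mulle u v u' v' : shape_top u <= shape_top u' -> shape_top v <= shape_top v' ->
    shape_top (shape_mul u v) <= shape_top (shape_mul u' v').
  by move=> h k; rewrite !top_mul (le_trans (le_mul0r _ h))// le_mul0l.
move=> /shape_add_null[eab|[_ bi]|[ba ai]] /shape_add_null[ece|[ce ei]|[ec ci]].
- by apply/shape_add_null; apply: Or31; rewrite !top_mul eab ece.
- by apply: shape_add_null_le; rewrite ?isitv_mul ?ei ?orbT// mulle// ltW.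
- rewrite shape_addC; apply: shape_add_null_le; rewrite ?isitv_mul ?ci ?orbT//.
  by rewrite mulle ?eab// ltW.
- by apply: shape_add_null_le; rewrite ?isitv_mul ?bi// mulle// ece.
- by apply: shape_add_null_le; rewrite ?isitv_mul ?bi// mulle// ltW.
- case/orP: (le_total (shape_top (shape_mul a c)) (shape_top (shape_mul b e))) => h.
    by apply: shape_add_null_le; rewrite ?isitv_mul ?bi.
  by rewrite shape_addC; apply: shape_add_null_le; rewrite ?isitv_mul ?ci ?orbT.
all: by rewrite ltNge ab in ba.
Qed.

Definition KGamma : fuzzyRing.
Proof.
refine (@FuzzyRing KGamma_sort KGamma_add KGamma_mul KGamma_zero KGamma_one
  KGamma_one KGamma_null _ _ _ _ _ _ _ _ _ _ _ _ _ _ _ _).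
- move=> A B C; rewrite -(shape_ofK A) -(shape_ofK B) -(shape_ofK C).
  by rewrite !KGamma_addE shape_addA.
- move=> A B; rewrite -(shape_ofK A) -(shape_ofK B).
  by rewrite !KGamma_addE shape_addC.
- move=> A; rewrite -(shape_ofK A) KGamma_addE shape_add_topE /=.
  have [e0|n0] := eqVneq (shape_top (shape_of A)) zero0; last by rewrite lt_0x n0.
  by rewrite e0 ltxx KGamma_itv0 KGamma_top0.
- move=> A B C; rewrite -(shape_ofK A) -(shape_ofK B) -(shape_ofK C).
  by rewrite !KGamma_mulE shape_mulA.
- move=> A B; rewrite -(shape_ofK A) -(shape_ofK B).
  by rewrite !KGamma_mulE shape_mulC.
- move=> A; rewrite -(shape_ofK A) KGamma_mulE; congr KGamma_of.
  exact: shape_mul1.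
- by move=> A; rewrite -(shape_ofK A) KGamma_mulE KGamma_top0// top_mul.
- by move=> A B C _; exact: KGamma_mulDr.
- by rewrite KGamma_mulE /shape_mul /= mulg1.
- move=> A B; rewrite -(shape_ofK A) -(shape_ofK B) KGamma_addE.
  move=> /KGamma_nullE uA /KGamma_nullE uB; apply/KGamma_nullE.
  by rewrite shape_add_topE; case: ifP => // _; case: ifP.
- move=> A B; rewrite -(shape_ofK A) -(shape_ofK B) KGamma_mulE.
  move=> /KGamma_nullE uB; apply/KGamma_nullE; rewrite isitv_mul top_mul mul0_eq0.
  by case/orP: uB => ->; rewrite !orbT.
- by [].
- by [].
- move=> A; rewrite -(shape_ofK A) => /KGamma_unit[a -> a0]; rewrite KGamma_addE.
  split=> [/KGamma_nullE/shape_add_null /=|].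
    by case=> [<-|[]|[]].
  move=> /(congr1 sval) /= /(congr1 (fun A => A one0)) /= e.
  have <- : one0 = a by rewrite e.
  by apply/KGamma_nullE => /=; rewrite eqxx.
- move=> A B C D AB CD; rewrite (_ : KGamma_mul KGamma_one _ = KGamma_mul B D).
    exact: KGamma_nullMM.
  rewrite -(shape_ofK B) -(shape_ofK D) !KGamma_mulE; congr KGamma_of.
  exact: shape_mul1.
- move=> A B C D; rewrite KGamma_mulDr.
  move: (KGamma_mul B C) (KGamma_mul B D) => {B C D} B C.
  rewrite -(shape_ofK A) -(shape_ofK B) -(shape_ofK C).
  by rewrite !KGamma_addE shape_addA.
Defined.

Definition KGamma_set (A : KGamma) : set (with_zero G) := sval A.

End WithZero.

(* Main.v *)
Require Import Defs.
From mathcomp Require Import all_boot all_order.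
From mathcomp Require Import boolp classical_sets.

(** Both fuzzy rings are families of subsets of the hyperfield [HGamma], and
    both multiply subsets elementwise and call a subset null when it contains
    zero.  The isomorphism is the identity on subsets, so two points remain.

    The additions agree: the case table that defines the sum of shapes computes
    the hypersum of subsets ([setadd_shape_set]).  The table says that the
    summand with the larger top absorbs the other and that equal tops produce
    an interval; for hypersums, writing [0, a] as a + a reduces the sum of two
    intervals to that of a point and an interval.

    The families agree: a finite hypersum is an iterated sum of singletons,
    hence a shape by the first point, and [0, a] = a + a is conversely a
    hypersum.

    A bijection that preserves all operations and null elements is an
    isomorphism for strong morphisms ([strong_morphism_of_hom]), and the two
    directions are symmetric, because each carrier embeds in the subsets of
    [HGamma]. *)

Set Implicit Arguments.
Unset Strict Implicit.
Unset Printing Implicit Defensive.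

Import Order.TTheory.
Local Open Scope order_scope.
Local Open Scope classical_set_scope.

Lemma strong_morphism_of_hom (K L : fuzzyRing) (f : K -> L) :
  f (fone K) = fone L -> f (fzero K) = fzero L ->
  {morph f : a b / fadd a b} -> {morph f : a b / fmul a b} ->
  (forall a, fnull a -> fnull (f a)) ->
  strong_morphism f.
Proof.
move=> f1 f0 fD fM fN; split=> // n a b /fN.
rewrite (big_morph f fD f0); congr fnull.
by apply: eq_bigr => i _; exact: fM.
Qed.

Section ShapesAreHypersums.
Variables (d : Order.disp_t) (G : orderedAbelianGroupType d).
Implicit Types (x y : with_zero G) (u v : Defs.shape G).

Local Notation H := (HGamma G).

Lemma setaddxx x : @setadd H [set x] [set x] = itv0 x.
Proof. by rewrite setadd1 /= HGamma_addxx. Qed.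

(** An interval is the sum of its top with itself, so the absorption of a point
    by an interval extends to the absorption of an interval. *)
Lemma setadd_shape_itv u y : shape_top u <= y ->
  @setadd H (shape_set u) (itv0 y) = itv0 y.
Proof.
case: u => x /= xy; first exact: HGamma_add1_itv.
by rewrite -setaddxx -setaddA !HGamma_add1_itv.
Qed.

Lemma setadd_shape_lt u v : shape_top u < shape_top v ->
  @setadd H (shape_set u) (shape_set v) = shape_set v.
Proof.
case: v => y /= uy; last by rewrite setadd_shape_itv// ltW.
case: u uy => x /= xy; last by rewrite setaddC HGamma_add1_itv_lt.
by rewrite setadd1 /= HGamma_add_lt.
Qed.

Lemma setadd_shape_eq u v : shape_top u = shape_top v ->
  @setadd H (shape_set u) (shape_set v) = itv0 (shape_top u).
Proof.
case: v => y /= uy; last by rewrite setadd_shape_itv uy.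
case: u uy => x /= ->; first exact: setaddxx.
by rewrite setaddC HGamma_add1_itv.
Qed.

Lemma setadd_shape_set u v :
  @setadd H (shape_set u) (shape_set v) = shape_set (shape_add u v).
Proof.
rewrite shape_add_topE; case: ltgtP => uv; first exact: setadd_shape_lt.
  by rewrite setaddC setadd_shape_lt.
exact: setadd_shape_eq.
Qed.

Lemma sumset_shape (A : set H) : sumset A -> exists u, A = shape_set u.
Proof.
case=> a [s ->]; elim: s a => [|b s IH] a; first by exists (Single a).
have [u Eu] := IH b; exists (shape_add (Single a) u).
by rewrite -setadd_shape_set -Eu.
Qed.

Lemma shape_sumset (A : set H) : (exists u, A = shape_set u) -> sumset A.
Proof.
case=> -[x|x] ->; first exact: sumset1.
by rewrite /= -setaddxx; apply: sumset_add; exact: sumset1.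
Qed.

Lemma KGamma_setD (A B : KGamma G) :
  KGamma_set (fadd A B) = @setadd H (KGamma_set A) (KGamma_set B).
Proof.
rewrite -(shape_ofK A) -(shape_ofK B) [fadd _ _]KGamma_addE.
exact/esym/setadd_shape_set.
Qed.

Local Notation F := (Fbar (@HGamma_dd d G)).

Definition Fbar_to_KGamma (A : F) : KGamma G :=
  exist _ (sval A) (sumset_shape (svalP A)).

Definition KGamma_to_Fbar (A : KGamma G) : F :=
  exist _ (sval A) (shape_sumset (svalP A)).

Lemma Fbar_to_KGamma_strong : strong_morphism Fbar_to_KGamma.
Proof.
apply: strong_morphism_of_hom => [||A B|A B|//]; apply: KGamma_inj => //.
exact/esym/KGamma_setD.
Qed.

Lemma KGamma_to_Fbar_strong : strong_morphism KGamma_to_Fbar.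
Proof.
apply: strong_morphism_of_hom => [||A B|A B|//]; apply: sumset_inj => //.
exact: KGamma_setD.
Qed.

Lemma Fbar_to_KGammaK : cancel Fbar_to_KGamma KGamma_to_Fbar.
Proof. by move=> A; exact: sumset_inj. Qed.

Lemma KGamma_to_FbarK : cancel KGamma_to_Fbar Fbar_to_KGamma.
Proof. by move=> A; exact: KGamma_inj. Qed.

End ShapesAreHypersums.

Theorem theorem5 (d : Order.disp_t) (G : orderedAbelianGroupType d) :
  exists phi : fuzzyIso (Fbar (@HGamma_dd d G)) (KGamma G),
    forall A : Fbar (@HGamma_dd d G), KGamma_set (phi A) = Fbar_set A.
Proof.
by exists (FuzzyIso (@Fbar_to_KGamma_strong d G) (@KGamma_to_Fbar_strong d G)
  (@Fbar_to_KGammaK d G) (@KGamma_to_FbarK d G)).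
Qed.
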